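(* Let $(\lambda_n)_{n=0}^\infty$ be positive numbers satisfying the following hypotheses: (i) $\sum_n \frac{1}{\lambda_n} = +\infty$; (ii) $(\lambda_n)_n$ is non-decreasing, or there exists $C>1$ such that for all $n\geq 1$: $C^{-1} \lambda_n \leq \lambda_k \leq C \lambda_n$ for all $n\leq k \leq 2n$. Then there exists (and can be constructed) a positive $f\in L^2(\mathbb{T},dm)$ such that $f$ is everywhere locally unbounded and satisfies $$\sum_{n\in\mathbb{Z}} |\widehat{f}(n)|^2 \lambda_{|n|} < \infty.$$
   Context: $\mathbb{T}$ is the unit circle, $m$ is the unit-normalized arc-length measure on $\mathbb{T}$, and $\widehat{f}(n)=\int_{\mathbb{T}}f(\zeta)\zeta^{-n}\,dm(\zeta)$, $n\in\mathbb{Z}$. A measurable function $f$ on $\mathbb{T}$ is everywhere locally unbounded if for any arc $I\subset\mathbb{T}$ and any number $M>0$ we have $m(\{\zeta\in I: |f(\zeta)|>M\})>0$. *)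

(* Defs.v *)
From HB Require Import structures.
From mathcomp Require Import all_boot all_order all_algebra.
From mathcomp Require Import all_classical all_reals all_analysis.
From mathcomp Require Import measurable_realfun complex.

Set Implicit Arguments.
Unset Strict Implicit.
Unset Printing Implicit Defensive.

Import Order.TTheory GRing.Theory Num.Theory.
Import numFieldNormedType.Exports.

Local Open Scope classical_set_scope.
Local Open Scope ring_scope.
Local Open Scope complex_scope.

Definition circle (R : realType) : Type := {z : R[i] | Normc.normc z == 1}.

Section circle.
Context (R : realType).

HB.instance Definition _ :=
  SubChoice.copy (circle R) {z : R[i] | Normc.normc z == 1}.

Lemma normc_one : Normc.normc (1 : R[i]) == 1.
Proof. by rewrite Normc.normc1. Qed.

HB.instance Definition _ := isPointed.Build (circle R) (exist _ 1 normc_one).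

Definition circle_coords (z : circle R) : R * R :=
  (complex.Re (val z), complex.Im (val z)).

(* The Borel sigma-algebra of the circle is the trace of that of the plane. *)
HB.instance Definition _ := Measurable.copy (circle R)
  (g_sigma_algebra_preimageType circle_coords).

Lemma normc_cos_sin (t : R) : Normc.normc (cos t +i* sin t) == 1.
Proof. by rewrite /= cos2Dsin2 sqrtr1. Qed.

(* t |-> e^{2 pi i t} *)
Definition expi2pi (t : R) : circle R :=
  exist _ (cos (2 * pi * t) +i* sin (2 * pi * t)) (normc_cos_sin (2 * pi * t)).

Lemma measurable_expi2pi : measurable_fun [set: R] expi2pi.
Proof.
have m2 : measurable_fun [set: R] (fun t : R => 2 * pi * t).
  by apply: mulrl_measurable.
have mc : measurable_fun [set: R] (fun t : R => circle_coords (expi2pi t)).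
  apply: measurable_fun_pair => /=.
  - apply: measurableT_comp m2; apply: continuous_measurable_fun.
    exact: continuous_cos.
  - apply: measurableT_comp m2; apply: continuous_measurable_fun.
    exact: continuous_sin.
move=> mT _ [B mB <-]; rewrite [X in _ @^-1` X]setTI; exact: mc.
Qed.

HB.instance Definition _ :=
  isMeasurableFun.Build _ _ _ _ expi2pi measurable_expi2pi.

(* e^{2 pi i t} runs once, at constant speed, around the circle as t runs
   through [0, 1[, so this image of Lebesgue measure is normalized arc length. *)
Definition arc_length : set (circle R) -> \bar R :=
  pushforward (mrestr (@lebesgue_measure R) (measurable_itv `[0, 1[)) expi2pi.

Lemma arc_length0 : arc_length set0 = 0%E.
Proof. by apply: measure0; exact: measurable_expi2pi. Qed.

Lemma arc_length_ge0 A : (0 <= arc_length A)%E.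
Proof. by apply: measure_ge0; exact: measurable_expi2pi. Qed.

Lemma arc_length_sigma_additive : semi_sigma_additive arc_length.
Proof. by apply: measure_semi_sigma_additive; exact: measurable_expi2pi. Qed.

HB.instance Definition _ := isMeasure.Build _ _ _ arc_length
  arc_length0 arc_length_ge0 arc_length_sigma_additive.

Lemma arc_length_setT : arc_length setT = 1%E.
Proof.
rewrite /arc_length /pushforward preimage_setT /mrestr setTI.
by rewrite lebesgue_measure_itv/= lte_fin ltr01 oppr0 adde0.
Qed.

HB.instance Definition _ :=
  Measure_isProbability.Build _ _ _ arc_length arc_length_setT.

Definition circle_integral (g : circle R -> R[i]) : R[i] :=
  (\int[arc_length]_z complex.Re (g z)) +i*
  (\int[arc_length]_z complex.Im (g z)).

Definition fourier_coef (f : circle R -> R) (n : int) : R[i] :=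
  circle_integral (fun z => (f z)%:C * val z ^ (- n)).

(* Every nondegenerate arc contains some open_arc a b with a < b, so testing
   local unboundedness on open arcs amounts to testing it on all arcs. *)
Definition open_arc (a b : R) : set (circle R) := expi2pi @` `]a, b[.

Definition everywhere_locally_unbounded (f : circle R -> R) : Prop :=
  forall a b M : R, a < b -> 0 < M ->
    (0 < arc_length (open_arc a b `&` [set z | (M < `|f z|)%R]))%E.

End circle.

(* Main.v *)
Require Import Defs.
From mathcomp Require Import all_boot all_order all_algebra.
From mathcomp Require Import all_classical all_reals all_analysis.
From mathcomp Require Import complex.
From mathcomp Require Import measurable_realfun zify ring lra.

Set Implicit Arguments.
Unset Strict Implicit.
Unset Printing Implicit Defensive.

Import Order.TTheory GRing.Theory Num.Theory.
Import numFieldNormedType.Exports.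
Import Normc.

Local Open Scope classical_set_scope.
Local Open Scope ring_scope.

(* Sums of nonnegative functions cannot cancel, so it suffices to find, for
   every r, B, e > 0, a nonnegative cosine polynomial P of weighted norm at most
   e with P > B at all 2^r-th roots of unity; f is the sum of a sequence of such
   P, preceded by the constant 1.

   To build P, let V_m(w) = Re(w^(3m)) F_m(w) / m, with F_m the Fejer kernel:
   V_m(1) = 1, the frequencies of V_m lie in (2m, 4m), and its coefficients are
   at most 1/m. At distance d from 1, V_m is nonnegative when 3 m d <= 1 and at
   least -4 / (m d)^2 otherwise, so sum_i a_i V_(2^i) >= -48 as soon as
   0 <= a_i <= 1. Take P(w) = b (48 + sum_(i < I) a_(r+i) V_(2^i)(w^(2^r))) with
   a_j = min(1, 2^j / M_j), where M_j bounds lambda on (2^(j+1), 2^(j+2)). The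
   frequency blocks are disjoint, so with A = sum_(i < I) a_(r+i) the energy of
   P is O(b^2 (1 + 2^r A)), whereas P >= b A at the 2^r-th roots of unity.
   Cauchy condensation makes A unbounded, and b = B / A does the job. *)

(** * Modulated Fejer kernels *)

Lemma normcX (R : rcfType) (w : R[i]) n : normc (w ^+ n) = normc w ^+ n.
Proof. by elim: n => [|n IH]; rewrite ?expr0 ?normc1// !exprS normcM IH. Qed.

Lemma Re_le_normc (R : rcfType) (w : R[i]) : complex.Re w <= normc w.
Proof.
case: w => a b /=; apply: le_trans (ler_norm a) _.
by rewrite -sqrtr_sqr ler_wsqrtr// lerDl sqr_ge0.
Qed.

Lemma normcD (R : rcfType) (v w : R[i]) : normc (v + w) <= normc v + normc w.
Proof. exact: (@le_normcD R v w). Qed.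

Lemma ReM_real (R : rcfType) (w : R[i]) (x : R) :
  complex.Re (w * x%:C%C) = complex.Re w * x.
Proof. by case: w => a b /=; rewrite mulr0 subr0. Qed.

Lemma mulc_conj (R : rcfType) (w : R[i]) : w * w^*%C = (normc w ^+ 2)%:C%C.
Proof.
by rewrite -sqr_normc normc_def rmorphXn /=; case: w.
Qed.

Lemma unit_circle_conj (R : rcfType) (w : R[i]) : normc w = 1 -> w^*%C = w^-1.
Proof.
move=> w1; have w0 : w != 0.
  by apply/eqP => w0; move: w1; rewrite w0 normc0 => /esym/eqP; rewrite oner_eq0.
by apply: (mulfI w0); rewrite mulc_conj w1 expr1n divff.
Qed.

(** Telescoping: passing from n to n + 1 adds w^n (1 - w), of modulus |1 - w|. *)
Lemma normc_1subX (R : rcfType) (w : R[i]) n : normc w = 1 ->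
  normc (1 - w ^+ n) <= n%:R * normc (1 - w).
Proof.
move=> w1; elim: n => [|n IH]; first by rewrite expr0 subrr normc0 mul0r.
have -> : 1 - w ^+ n.+1 = (1 - w ^+ n) + w ^+ n * (1 - w) by rewrite exprSr; ring.
apply: (le_trans (normcD _ _)).
by rewrite normcM normcX w1 expr1n mul1r -natr1 mulrDl mul1r lerD2r.
Qed.

Lemma Re_expr_ge0 (R : rcfType) (w : R[i]) n : normc w = 1 ->
  n%:R * normc (1 - w) <= 1 -> 0 <= complex.Re (w ^+ n).
Proof.
move=> w1 nw.
have -> : complex.Re (w ^+ n) = 1 - complex.Re (1 - w ^+ n).
  by case: (w ^+ n) => a b /=; lra.
rewrite subr_ge0; apply: (le_trans (Re_le_normc _)).
exact: le_trans (normc_1subX _ w1) nw.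
Qed.

(* V_m(w), where F_m(w) = (sum_(j < m) w^j) (sum_(k < m) w^-k) / m; the shift by 3m makes all
   exponents positive, so that natural powers suffice. *)
Definition mfejer (R : rcfType) (m : nat) (w : R[i]) : R :=
  (\sum_(j < m) \sum_(k < m) complex.Re (w ^+ (3 * m + j - k))) / m%:R ^+ 2.

(** On the unit circle w^-k is the conjugate of w^k, so the double sum factors as w^(3m) times
    |sum_j w^j|^2. The natural-number subtraction is exact because k < m. *)
Lemma mfejerE (R : rcfType) m (w : R[i]) : normc w = 1 ->
  mfejer m w = complex.Re (w ^+ (3 * m)) * normc (\sum_(j < m) w ^+ j) ^+ 2 / m%:R ^+ 2.
Proof.
move=> w1; congr (_ / _); rewrite -ReM_real -mulc_conj.
have w0 : w != 0.
  by apply/eqP => w0; move: w1; rewrite w0 normc0 => /esym/eqP; rewrite oner_eq0.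
rewrite rmorph_sum/= mulr_suml mulr_sumr raddf_sum; apply: eq_bigr => j _ /=.
rewrite !mulr_sumr raddf_sum; apply: eq_bigr => k _; congr complex.Re.
rewrite rmorphXn/= unit_circle_conj// exprVn expfB; last by have := ltn_ord k; lia.
by rewrite exprD mulrA.
Qed.

Lemma mfejer_ge0 (R : rcfType) m (w : R[i]) : normc w = 1 ->
  (3 * m)%:R * normc (1 - w) <= 1 -> 0 <= mfejer m w.
Proof.
move=> w1 h; rewrite mfejerE// divr_ge0 ?sqr_ge0// mulr_ge0 ?sqr_ge0//.
exact: Re_expr_ge0.
Qed.

Lemma normc_ge0 (R : rcfType) (w : R[i]) : 0 <= normc w.
Proof. by case: w => a b; exact: sqrtr_ge0. Qed.

(** The geometric sum S satisfies |S| |1 - w| = |1 - w^m| <= 2, and Re(w^(3m)) >= -1. *)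
Lemma mfejer_ge (R : rcfType) m (w : R[i]) : normc w = 1 ->
  - (2 / (m%:R * normc (1 - w))) ^+ 2 <= mfejer m w.
Proof.
move=> w1; have [w_eq1|w_neq1] := eqVneq w 1.
  (* At w = 1 the convention 1/0 = 0 turns the lower bound into 0. *)
  rewrite w_eq1 subrr normc0 mulr0 invr0 mulr0 expr0n oppr0.
  by apply: mfejer_ge0; rewrite ?normc1// subrr normc0 mulr0.
rewrite mfejerE//; set S := normc (\sum_(j < m) _).
have d0 : 0 < normc (1 - w).
  rewrite lt0r normc_ge0 andbT; apply: contra_neq w_neq1 => /eq0_normc.
  by move/eqP; rewrite subr_eq0 => /eqP.
have Sd : S * normc (1 - w) <= 2.
  rewrite -normcM mulrC -opprB mulNr -subrX1 normcN.
  apply: (le_trans (normcD _ _)); rewrite normcN normcX w1 expr1n normc1.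
  by rewrite -natr1.
have Re_ge : -1 <= complex.Re (w ^+ (3 * m)).
  rewrite lerNl -raddfN; apply: (le_trans (Re_le_normc _)).
  by rewrite normcN normcX w1 expr1n.
have S0 : 0 <= S by exact: normc_ge0.
apply: (@le_trans _ _ (- (S ^+ 2 / m%:R ^+ 2))).
  have -> : (2 / (m%:R * normc (1 - w))) ^+ 2 = (2 / normc (1 - w)) ^+ 2 / m%:R ^+ 2.
    by rewrite invfM mulrCA mulrC exprMn exprVn.
  rewrite lerN2 ler_wpM2r ?invr_ge0 ?sqr_ge0//.
  by rewrite ler_pXn2r ?nnegrE ?divr_ge0// ?normc_ge0// ler_pdivlMr.
rewrite -mulNr ler_wpM2r ?invr_ge0 ?sqr_ge0// -mulN1r.
rewrite ler_wpM2r ?sqr_ge0//.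
Qed.

Lemma mfejer1 (R : rcfType) m : (0 < m)%N -> mfejer m (1 : R[i]) = 1.
Proof.
move=> m0; rewrite /mfejer.
under eq_bigr do under eq_bigr do rewrite expr1n /=.
rewrite !sumr_const !card_ord -mulrnA mulnn natrX divff//.
by rewrite expf_eq0 pnatr_eq0 -lt0n m0.
Qed.

(** Past the threshold 1 the terms decay by the factor 1/4, whence 4/3. Stating the bound in two
    cases lets the induction replace x by 2x. *)
Lemma sum_lacunary (R : realFieldType) I (x : R) : 0 <= x ->
  \sum_(i < I) (if 1 < 2 ^+ i * x then (2 ^+ i * x) ^- 2 else 0) <=
  if 1 < x then 4 / 3 * x ^- 2 else 4 / 3.
Proof.
elim: I x => [|I IH] x x0.
  by rewrite big_ord0; case: ifP => _; rewrite ?mulr_ge0 ?invr_ge0 ?sqr_ge0//; lra.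
rewrite big_ord_recl expr0 mul1r.
have E (i : 'I_I) : 2 ^+ lift ord0 i * x = 2 ^+ i * (2 * x).
  by rewrite [in LHS]exprSr mulrA.
under eq_bigr do rewrite E.
have := IH (2 * x) ltac:(lra); set s := \sum_(i < I) _.
have -> : (2 * x) ^- 2 = x ^- 2 / 4 :> R.
  by rewrite exprMn invfM mulrC; congr (_ * _); rewrite -natrX.
have [x1|x1] := ltP 1 x.
  rewrite ifT; last lra.
  by set y := x ^- 2; lra.
have [|] := ltP 1 (2 * x) => x2; last by rewrite add0r.
(* Here x <= 1 < 2x: the remaining sum is at most x^-2 / 3, and x^-2 <= 4. *)
rewrite add0r => /le_trans; apply.
have : x ^- 2 <= 4.
  rewrite invf_ple ?posrE ?exprn_gt0//; nra.
lra.
Qed.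

(* With x = 3 |1 - w|, the i-th term is at least -36 (2^i x)^-2, and it is
   nonnegative unless 2^i x > 1; hence 48 = 36 * 4/3. *)
Lemma mfejer_sum_ge (R : rcfType) I (a : nat -> R) (w : R[i]) : normc w = 1 ->
  (forall i, 0 <= a i <= 1) -> - 48 <= \sum_(i < I) a i * mfejer (2 ^ i) w.
Proof.
move=> w1 a01; set d := normc (1 - w); have d0 : 0 <= d by exact: normc_ge0.
have := @sum_lacunary R I (3 * d) ltac:(lra).
set s := \sum_(i < I) _ => hs.
have {hs} : s <= 4 / 3.
  apply: le_trans hs _; case: ltP => // h.
  have : (3 * d) ^- 2 <= 1 by rewrite invf_le1 ?exprn_gt0 ?expr_ge1//; lra.
  lra.
suff : - (36 * s) <= \sum_(i < I) a i * mfejer (2 ^ i) w by lra.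
rewrite mulr_sumr -sumrN; apply: ler_sum => i _.
have /andP[a0 a1] := a01 i.
case: ifPn => [h|]; last first.
  rewrite -leNgt mulr0 oppr0 => h; rewrite mulr_ge0// mfejer_ge0//.
  by rewrite natrM natrX -/d mulrAC -mulrA mulrC -mulrA mulrC -mulrA.
have := @mfejer_ge R (2 ^ i) w w1; rewrite -/d => h1.
have <- : (2 / ((2 ^ i)%:R * d)) ^+ 2 = 36 * (2 ^+ i * (3 * d)) ^- 2.
  rewrite natrX; have ? : 2 ^+ i != 0 :> R by rewrite expf_neq0 ?pnatr_eq0.
  have ? : d != 0 by apply: contraTneq h => ->; rewrite !mulr0 -leNgt.
  by field; apply/andP.
(* Since y >= 0, the lower bound -y survives multiplication by a factor in [0, 1]. *)
have : 0 <= (2 / ((2 ^ i)%:R * d)) ^+ 2 by exact: sqr_ge0.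
set y := (_ ^+ 2) in h1 * => y0; set b := mfejer _ _ in h1 *.
nra.
Qed.

(** The coefficient of Re(w^n) in V_m(w^q): the count of pairs (j, k) whose dilated frequency is n,
    normalized by m^2. *)
Definition mfejer_coef (R : rcfType) (q m n : nat) : R :=
  (\sum_(j < m) \sum_(k < m) (q * (3 * m + j - k) == n))%N%:R / m%:R ^+ 2.

Lemma mfejer_coef_ge0 (R : rcfType) q m n : 0 <= mfejer_coef R q m n.
Proof. by rewrite divr_ge0 ?sqr_ge0. Qed.

(** Since |j - k| < m, each frequency 3m + j - k lies strictly between 2m and 4m; strictness is what
    makes consecutive dyadic blocks disjoint. *)
Lemma mfejer_coef_supp (R : rcfType) q m n : mfejer_coef R q m n != 0 -> (0 < q)%N ->
  (q * (2 * m) < n < q * (4 * m))%N.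
Proof.
move=> + q0; apply: contraNT => h; rewrite /mfejer_coef big1 ?mul0r// => j _.
rewrite big1// => k _; apply/eqP; rewrite eqb0; apply: contraNneq h => <-.
have := ltn_ord j; have := ltn_ord k; rewrite !ltn_mul2l q0 /=; lia.
Qed.

(** Each pair (j, k) hits exactly one n below L. A general [F] serves twice: cosines recover the
    kernel, and constants show that the coefficients have total mass 1 for m > 0. *)
Lemma mfejer_coef_sum (R : rcfType) q m L (F : nat -> R) : (0 < q)%N ->
  (q * (4 * m) <= L)%N ->
  \sum_(n < L) mfejer_coef R q m n * F n =
  (\sum_(j < m) \sum_(k < m) F (q * (3 * m + j - k))%N) / m%:R ^+ 2.
Proof.
move=> q0 mL; rewrite mulr_suml.
transitivity (\sum_(n < L) \sum_(j < m) \sum_(k < m)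
    (q * (3 * m + j - k) == n)%N%:R * F n / m%:R ^+ 2).
  apply: eq_bigr => n _; rewrite /mfejer_coef mulrAC natr_sum !mulr_suml.
  by apply: eq_bigr => j _; rewrite natr_sum !mulr_suml.
rewrite exchange_big; apply: eq_bigr => j _ /=.
rewrite mulr_suml exchange_big; apply: eq_bigr => k _ /=.
have lt : (q * (3 * m + j - k) < L)%N.
  apply: leq_trans mL; rewrite ltn_mul2l q0 /=.
  by have := ltn_ord j; have := ltn_ord k; lia.
rewrite (bigD1 (Ordinal lt))//= eqxx mul1r big1 ?addr0// => n.
by rewrite -val_eqE /= eq_sym => /negbTE ->; rewrite !mul0r.
Qed.

(** For fixed j at most one k produces the frequency n, so at most m of the m^2 pairs count. *)
Lemma mfejer_coef_le (R : rcfType) q m n : (0 < q)%N ->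
  mfejer_coef R q m n <= m%:R^-1.
Proof.
move=> q0; have [->|m0] := posnP m.
  by rewrite /mfejer_coef !big_ord0 mul0r invr0.
rewrite ler_pdivrMr ?exprn_gt0 ?ltr0n// expr2 mulrA mulVf ?mul1r ?pnatr_eq0 -?lt0n//.
rewrite ler_nat -[leqRHS]mul1n -[leqRHS]mulnC.
rewrite -[X in (_ <= X * _)%N]card_ord -sum_nat_const.
apply: leq_sum => j _.
have [k jk|nk] := pickP [pred k : 'I_m | q * (3 * m + j - k) == n]%N; last first.
  by rewrite big1// => k _; have := nk k; rewrite /= => ->.
move: jk => /= jk; rewrite (bigD1 k)//= jk big1// => k' k'k; apply/eqP; rewrite eqb0.
apply: contraNneq k'k => e; move: jk; rewrite -e eqn_pmul2l// => /eqP {}e.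
by apply/eqP/val_inj => /=; have := ltn_ord j; have := ltn_ord k; have := ltn_ord k'; lia.
Qed.

(** In each square one factor is at most 1/m and [lambda] is at most M on the block; the remaining
    factors sum to 1. *)
Lemma mfejer_coef_energy (R : rcfType) q m L (lambda : nat -> R) (M : R) :
  (0 < q)%N -> (0 < m)%N -> (q * (4 * m) <= L)%N ->
  (forall n, 0 <= lambda n) ->
  (forall n, (q * (2 * m) < n < q * (4 * m))%N -> lambda n <= M) ->
  \sum_(n < L) mfejer_coef R q m n ^+ 2 * lambda n <= M / m%:R.
Proof.
move=> q0 m0 mL l0 lM.
have -> : M / m%:R = \sum_(n < L) mfejer_coef R q m n * (M / m%:R).
  rewrite (mfejer_coef_sum (fun=> M / m%:R))//; under eq_bigr do rewrite sumr_const card_ord.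
  rewrite sumr_const card_ord -mulrnA mulnn -[_ *+ (m ^ 2)]mulr_natr natrX.
  by rewrite mulfK// expf_eq0 pnatr_eq0 -lt0n m0.
apply: ler_sum => n _; rewrite expr2 -mulrA.
have [->|c0] := eqVneq (mfejer_coef R q m n) 0; first by rewrite !mul0r.
rewrite ler_wpM2l ?mfejer_coef_ge0// mulrC ler_pM ?mfejer_coef_ge0 ?mfejer_coef_le//.
exact: (lM _ (mfejer_coef_supp c0 q0)).
Qed.

Lemma mfejer_powE (R : rcfType) q m L (w : R[i]) : (0 < q)%N ->
  (q * (4 * m) <= L)%N ->
  mfejer m (w ^+ q) = \sum_(n < L) mfejer_coef R q m n * complex.Re (w ^+ n).
Proof.
move=> q0 mL; rewrite (mfejer_coef_sum (fun n => complex.Re (w ^+ n)))//.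
by congr (_ / _); do 2 (apply: eq_bigr => ? _); rewrite exprM.
Qed.

Lemma sqr_sum_orthogonal (R : comPzRingType) I (u : 'I_I -> R) :
  (forall i j, i != j -> u i * u j = 0) ->
  (\sum_i u i) ^+ 2 = \sum_i u i ^+ 2.
Proof.
move=> uu; rewrite expr2 mulr_suml; apply: eq_bigr => i _.
rewrite mulr_sumr (bigD1 i)//= big1 ?addr0// => j ji.
by rewrite uu// eq_sym.
Qed.

(** * Peak polynomials *)

Definition peak_coef (R : rcfType) (a : nat -> R) (b : R) r I n : R :=
  b * (48 * (n == 0%N)%:R +
       \sum_(i < I) a (r + i)%N * mfejer_coef R (2 ^ r) (2 ^ i) n).

Definition cos_poly (R : rcfType) (c : nat -> R) L (w : R[i]) : R :=
  \sum_(n < L) c n * complex.Re (w ^+ n).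

Lemma pow2_gt0 k : (0 < 2 ^ k)%N.
Proof. by rewrite expn_gt0. Qed.

Lemma mul_pow2_2 r i : (2 ^ r * (2 * 2 ^ i) = 2 ^ (r + i).+1)%N.
Proof. by rewrite -expnS -expnD addnS. Qed.

Lemma mul_pow2_4 r i : (2 ^ r * (4 * 2 ^ i) = 2 ^ (r + i).+2)%N.
Proof. by rewrite -[4%N]/(2 * 2)%N -mulnA -!expnS -expnD !addnS. Qed.

Section peak.
Variables (R : rcfType) (a : nat -> R) (b : R) (r I : nat).
Hypothesis a01 : forall i, 0 <= a i <= 1.
Hypothesis b0 : 0 <= b.
(** A common length for all blocks: the last one stays below 2^(r + I + 1). *)
Let L := (2 ^ (r + I + 2))%N.
Let A := \sum_(i < I) a (r + i)%N.

Let L_gt0 : (0 < L)%N. Proof. by rewrite expn_gt0. Qed.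

Let le_L (i : 'I_I) : (2 ^ r * (4 * 2 ^ i) <= L)%N.
Proof.
rewrite /L mul_pow2_4 leq_exp2l//.
by have := ltn_ord i; lia.
Qed.

Lemma peak_coef_ge0 n : 0 <= peak_coef a b r I n.
Proof.
rewrite mulr_ge0// addr_ge0 ?mulr_ge0//; apply: sumr_ge0 => i _.
by rewrite mulr_ge0 ?mfejer_coef_ge0//; have /andP[] := a01 (r + i)%N.
Qed.

Lemma peak_polyE (w : R[i]) : cos_poly (peak_coef a b r I) L w =
  b * (48 + \sum_(i < I) a (r + i)%N * mfejer (2 ^ i) (w ^+ (2 ^ r))).
Proof.
rewrite /cos_poly; under eq_bigr do rewrite -mulrA mulrDl.
rewrite -mulr_sumr big_split /=; congr (_ * (_ + _)).
  rewrite (bigD1 (Ordinal L_gt0))//= !mulr1 big1 ?addr0// => n.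
  by rewrite -val_eqE /= => /negbTE ->; rewrite mulr0 mul0r.
under eq_bigr do rewrite mulr_suml.
rewrite exchange_big /=; apply: eq_bigr => i _.
rewrite (mfejer_powE _ _ (le_L i)) ?expn_gt0// mulr_sumr.
by apply: eq_bigr => n _; rewrite mulrA.
Qed.

Lemma peak_poly_ge0 (w : R[i]) : normc w = 1 ->
  0 <= cos_poly (peak_coef a b r I) L w.
Proof.
move=> w1; rewrite peak_polyE mulr_ge0//.
have := @mfejer_sum_ge R I (fun i => a (r + i)%N) (w ^+ (2 ^ r)).
rewrite normcX w1 expr1n => /(_ erefl (fun i => a01 _)); lra.
Qed.

(** At such a root the dilated variable w^(2^r) is 1, where every kernel equals 1. *)
Lemma peak_poly_root (w : R[i]) : w ^+ (2 ^ r) = 1 ->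
  cos_poly (peak_coef a b r I) L w = b * (48 + A).
Proof.
move=> w1; rewrite peak_polyE w1; congr (_ * (_ + _)).
by apply: eq_bigr => i _; rewrite mfejer1 ?expn_gt0// mulr1.
Qed.

Lemma peak_coef_sum : \sum_(n < L) peak_coef a b r I n = b * (48 + A).
Proof.
rewrite -(peak_poly_root (expr1n _ _)); apply: eq_bigr => n _.
by rewrite expr1n mulr1.
Qed.

Lemma peak_coef0 : peak_coef a b r I 0%N = b * 48.
Proof.
rewrite /peak_coef eqxx mulr1 big1 ?addr0// => i _; apply/eqP.
rewrite mulf_eq0; apply/orP; right.
by apply: contraT => /mfejer_coef_supp-/(_ (pow2_gt0 _)).
Qed.

(** Disjoint blocks leave no cross terms. Block i costs at most a^2 M / 2^i, with a and M taken at r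
    + i, and a M <= 2^(r + i) reduces this to 2^r a. *)
Lemma peak_energy (lambda M : nat -> R) : (forall n, 0 <= lambda n) ->
  (forall j n, (2 ^ j.+1 < n < 2 ^ j.+2)%N -> lambda n <= M j) ->
  (forall j, a j * M j <= 2 ^+ j) ->
  \sum_(n < L) peak_coef a b r I n ^+ 2 * lambda n <=
    b ^+ 2 * (48 ^+ 2 * lambda 0%N + 2 ^+ r * A).
Proof.
move=> l0 lM aM.
have pE n : peak_coef a b r I n ^+ 2 = b ^+ 2 * (48 ^+ 2 * (n == 0%N)%:R +
    \sum_(i < I) a (r + i)%N ^+ 2 * mfejer_coef R (2 ^ r) (2 ^ i) n ^+ 2).
  rewrite exprMn; congr (_ * _); have [->|n0] := eqVneq n 0%N.
    have c0 i : mfejer_coef R (2 ^ r) (2 ^ i) 0%N = 0.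
      by apply/eqP/contraT => /mfejer_coef_supp-/(_ (pow2_gt0 _)).
    rewrite big1 ?big1 ?addr0 ?mulr1// => i _; rewrite c0 ?expr0n mulr0//.
  rewrite !mulr0 !add0r sqr_sum_orthogonal; first by under eq_bigr do rewrite exprMn.
  move=> i j; apply: contraNeq; rewrite mulf_eq0 negb_or => /andP[].
  rewrite mulf_eq0 negb_or => /andP[_ /mfejer_coef_supp-/(_ (pow2_gt0 _)) ni].
  rewrite mulf_eq0 negb_or => /andP[_ /mfejer_coef_supp-/(_ (pow2_gt0 _)) nj].
  move: ni nj; rewrite !mul_pow2_2 !mul_pow2_4.
  case/andP => n1 n2 /andP[n3 n4]; apply/eqP/val_inj => /=.
  (* A frequency common to blocks i and j gives r + i + 1 < r + j + 2 and the converse, hence i =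
     j. *)
  have := ltn_trans n1 n4; have := ltn_trans n3 n2; rewrite !ltn_exp2l//; lia.
under eq_bigr do rewrite pE -mulrA mulrDl.
rewrite -mulr_sumr big_split /= ler_wpM2l ?sqr_ge0// lerD//.
  rewrite (bigD1 (Ordinal L_gt0))//= mulr1 big1 ?addr0// => n.
  by rewrite -val_eqE /= => /negbTE ->; rewrite mulr0 mul0r.
under eq_bigr do rewrite mulr_suml.
rewrite exchange_big /= mulr_sumr; apply: ler_sum => i _.
under eq_bigr do rewrite -mulrA.
rewrite -mulr_sumr; have /andP[a0 _] := a01 (r + i)%N.
have := @mfejer_coef_energy R (2 ^ r) (2 ^ i) L lambda (M (r + i)%N).
rewrite !expn_gt0 le_L => /(_ isT isT isT l0 _) h.
apply: (@le_trans _ _ (a (r + i)%N ^+ 2 * (M (r + i)%N / (2 ^ i)%:R))).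
  rewrite ler_wpM2l ?sqr_ge0// h// => n hn; apply: lM; move: hn.
  by rewrite mul_pow2_2 mul_pow2_4.
rewrite mulrA natrX ler_pdivrMr ?exprn_gt0//.
have -> : 2 ^+ r * a (r + i)%N * 2 ^+ i = a (r + i)%N * 2 ^+ (r + i).
  by rewrite exprD; ring.
by rewrite expr2 -mulrA ler_wpM2l.
Qed.

End peak.

(** The third bound controls the L2 norm through [integral_sqr_cos_poly]; the weighted energy alone
    does not when [lambda] tends to 0. *)
Lemma exists_peak (R : rcfType) (lambda M a : nat -> R) :
  (forall n, 0 <= lambda n) ->
  (forall j n, (2 ^ j.+1 < n < 2 ^ j.+2)%N -> lambda n <= M j) ->
  (forall j, 0 <= a j <= 1) -> (forall j, a j * M j <= 2 ^+ j) ->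
  (forall B : R, exists J, B <= \sum_(j < J) a j) ->
  forall r (B e : R), 0 < B -> 0 < e -> exists (L : nat) (c : nat -> R),
  [/\ forall n, 0 <= c n,
      \sum_(n < L.+1) c n ^+ 2 * lambda n <= e,
      c 0%N * \sum_(n < L.+1) c n <= e,
      forall w, normc w = 1 -> 0 <= cos_poly c L.+1 w &
      forall w : R[i], w ^+ (2 ^ r) = 1 -> B < cos_poly c L.+1 w].
Proof.
move=> l0 lM a01 aM adiv r B e B0 e0.
(* With b = B / A, each cost b^2 (x A) equals B^2 x / A, so A >= T brings it below e for every x up
   to the bracketed sum. The final 1 ensures A >= 1, which absorbs the terms not multiplied by A. *)
pose T := B ^+ 2 * (48 ^+ 2 * lambda 0%N + 2 ^+ r + 48 ^+ 2 + 48) / e + 1.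
have T1 : 1 <= T.
  rewrite lerDr divr_ge0 ?(ltW e0)// mulr_ge0 ?sqr_ge0// !addr_ge0 ?mulr_ge0 ?exprn_ge0//.
(* The peak uses only indices from r on, so the first r terms are added to the target; reaching it
   then forces r <= J. *)
have [J hJ] := adiv (T + \sum_(j < r) a j).
have rJ : (r <= J)%N.
  rewrite leqNgt; apply/negP => Jr; move: hJ; apply/negP; rewrite -ltNge.
  rewrite ltr_pwDl ?(lt_le_trans ltr01)// -(subnKC (ltnW Jr)) big_split_ord /=.
  by rewrite lerDl sumr_ge0// => i _; have /andP[] := a01 (J + i)%N.
pose I := (J - r)%N; pose A := \sum_(i < I) a (r + i)%N.
have TA : T <= A.
  move: hJ; rewrite -(subnKC rJ) big_split_ord /= -/I -/A.
  by rewrite [T + _]addrC lerD2l.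
have A0 : 0 < A by apply: lt_le_trans TA; exact: lt_le_trans T1.
have A1 : 1 <= A by exact: le_trans TA.
pose b := B / A.
have b0 : 0 <= b by rewrite divr_ge0 ?ltW.
have bA : b * A = B by rewrite divfK ?gt_eqF.
have key (x : R) : 0 <= x -> x <= 48 ^+ 2 * lambda 0%N + 2 ^+ r + 48 ^+ 2 + 48 ->
    b ^+ 2 * (x * A) <= e.
  move=> x0 xle.
  have -> : b ^+ 2 * (x * A) = B ^+ 2 * x / A.
    by rewrite /b; field; rewrite gt_eqF.
  rewrite ler_pdivrMr// -ler_pdivrMl// mulrC; apply: le_trans TA.
  apply: ler_wpDr => //; rewrite ler_wpM2r ?invr_ge0 ?(ltW e0)//.
  by rewrite ler_wpM2l ?sqr_ge0.
have r0 : 0 <= 2 ^+ r :> R by rewrite exprn_ge0.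
have l00 := l0 0%N.
exists (2 ^ (r + I + 2)).-1, (peak_coef a b r I).
rewrite prednK ?expn_gt0//; split.
- by move=> n; exact: peak_coef_ge0.
- apply: (le_trans (peak_energy r I a01 b0 l0 lM aM)).
  apply: (le_trans _ (key (48 ^+ 2 * lambda 0%N + 2 ^+ r) _ _)); last 2 first.
  + by rewrite addr_ge0 ?mulr_ge0 ?exprn_ge0//.
  + by rewrite -addrA lerDl addr_ge0 ?exprn_ge0//.
  rewrite ler_wpM2l ?sqr_ge0// -/A mulrDl lerD2r ler_peMr ?mulr_ge0 ?exprn_ge0//.
- rewrite peak_coef0 peak_coef_sum// -/A.
  apply: (le_trans _ (key (48 ^+ 2 + 48) _ _)); last 2 first.
  + by rewrite addr_ge0 ?exprn_ge0//.
  + by rewrite -addrA lerDr addr_ge0 ?mulr_ge0 ?exprn_ge0//.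
  have -> : b * 48 * (b * (48 + A)) = b ^+ 2 * (48 ^+ 2 + 48 * A) by ring.
  by rewrite ler_wpM2l ?sqr_ge0// [leRHS]mulrDl lerD2r ler_peMr ?exprn_ge0//.
- by move=> w; exact: peak_poly_ge0.
- move=> w /peak_poly_root -> //; rewrite -/A mulrDr bA ltrDr mulr_gt0//.
  by rewrite divr_gt0.
Qed.

(** * Dyadic weights *)

Definition unbounded_sums (R : realType) (x : nat -> R) :=
  forall B : R, exists J, B <= \sum_(j < J) x j.

Lemma nneseries_unbounded_sums (R : realType) (x : nat -> R) :
  (forall n, 0 <= x n) -> (\sum_(0 <= n <oo) (x n)%:E)%E = +oo%E ->
  unbounded_sums x.
Proof.
move=> x0 xoo B; apply: contrapT => /forallNP nB.
suff : (\sum_(0 <= n <oo) (x n)%:E <= B%:E)%E by rewrite xoo.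
apply: lime_le; first by apply: is_cvg_nneseries => n _ _; rewrite lee_fin.
apply: nearW => n; rewrite sumEFin lee_fin big_mkord ltW// ltNge.
exact/negP/nB.
Qed.

(** Either x <= 1 from some index on, and truncation changes finitely many terms; or x exceeds 1
    infinitely often, and the truncated sequence takes the value 1 infinitely often. *)
Lemma unbounded_sums_min1 (R : realType) (x : nat -> R) :
  (forall n, 0 <= x n) -> unbounded_sums x ->
  unbounded_sums (fun n => Num.min 1 (x n)).
Proof.
move=> x0 ux; set a := fun n => Num.min 1 (x n).
have a0 n : 0 <= a n by rewrite le_min ler01 x0.
have sumD (y : nat -> R) N k :
    \sum_(j < N + k) y j = \sum_(j < N) y j + \sum_(j < k) y (N + j)%N.
  by rewrite big_split_ord.
have [[N xN]|] := pselect (exists N, forall j, (N <= j)%N -> x j <= 1).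
  move=> B; have [J hJ] := ux (B + \sum_(j < N) x j); exists (N + J)%N.
  rewrite sumD; apply: ler_wpDl; first by rewrite sumr_ge0.
  have -> : \sum_(j < J) a (N + j)%N = \sum_(j < J) x (N + j)%N.
    by apply: eq_bigr => j _; apply/min_idPr/xN; rewrite leq_addr.
  rewrite -(lerD2r (\sum_(j < N) x j)); apply: (le_trans hJ).
  rewrite addrC -sumD.
  by rewrite addnC sumD lerDl sumr_ge0.
move=> /forallNP xoo.
have {}xoo N : exists2 j, (N <= j)%N & a j = 1.
  apply: contrapT => h; apply: (xoo N) => j Nj.
  by rewrite leNgt; apply/negP => xj; apply: h; exists j => //; apply/min_idPl/ltW.
have cnt k : exists J, k%:R <= \sum_(j < J) a j.
  elim: k => [|k [J hJ]]; first by exists 0%N; rewrite big_ord0.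
  have [j Jj aj] := xoo J; exists j.+1; rewrite big_ord_recr /= aj -natr1 lerD2r.
  apply: (le_trans hJ); rewrite -(subnKC Jj) sumD lerDl sumr_ge0//.
move=> B; have [J hJ] := cnt (Num.bound `|B|); exists J; apply: le_trans hJ.
by apply: (le_trans (ler_norm _)); rewrite ltW// archi_boundP.
Qed.

(** M j bounds [lambda] on one dyadic block yet is comparable to it on the next, so that divergence
    passes from 1/lambda to 2^j / M j. In the doubling case the exponent 3 counts the factor C in M
    j and two doubling steps, from 2^(j+1) to 2^(j+2) and from there to n. *)
Lemma dyadic_majorant (R : realType) (lambda : nat -> R) :
  (forall n, 0 < lambda n) ->
  (nondecreasing_seq lambda \/
    exists2 C : R, 1 < C & forall n k : nat, (1 <= n)%N -> (n <= k <= 2 * n)%N ->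
      C^-1 * lambda n <= lambda k <= C * lambda n) ->
  exists (M : nat -> R) (D : R), [/\ 0 < D,
    forall j, 0 < M j,
    forall j n, (2 ^ j.+1 < n < 2 ^ j.+2)%N -> lambda n <= M j &
    forall j n, (2 ^ j.+2 <= n < 2 ^ j.+3)%N -> M j <= D * lambda n].
Proof.
move=> l0 [ndl|[C C1 lC]].
  exists (fun j => lambda (2 ^ j.+2)%N), 1; split => // j n /andP[h1 h2].
    by apply: ndl; exact: ltnW.
  by rewrite mul1r; apply: ndl.
have C0 : 0 < C by lra.
exists (fun j => C * lambda (2 ^ j.+1)%N), (C ^+ 3).
split => [||j n /andP[h1 h2]|j n /andP[h1 h2]].
- exact: exprn_gt0.
- by move=> j; rewrite mulr_gt0.
- have /andP[_ ->//] := lC (2 ^ j.+1)%N n ltac:(by rewrite expn_gt0)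
    ltac:(by rewrite (ltnW h1) -expnS ltnW).
- have /andP[+ _] := lC (2 ^ j.+1)%N (2 ^ j.+2)%N ltac:(by rewrite expn_gt0)
    ltac:(by rewrite leq_exp2l//= leqnSn -expnS leqnn).
  have /andP[+ _] := lC (2 ^ j.+2)%N n ltac:(by rewrite expn_gt0)
    ltac:(by rewrite h1 -expnS ltnW).
  rewrite !ler_pdivrMl// => u v; rewrite exprS -mulrA ler_pM2l//.
  apply: (le_trans v); rewrite expr2 -mulrA ler_pM2l//.
Qed.

Lemma dyadic_weights (R : realType) (lambda : nat -> R) :
  (forall n, 0 < lambda n) ->
  unbounded_sums (fun n => (lambda n)^-1) ->
  (nondecreasing_seq lambda \/
    exists2 C : R, 1 < C & forall n k : nat, (1 <= n)%N -> (n <= k <= 2 * n)%N ->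
      C^-1 * lambda n <= lambda k <= C * lambda n) ->
  exists a M : nat -> R, [/\
    forall j n, (2 ^ j.+1 < n < 2 ^ j.+2)%N -> lambda n <= M j,
    forall j, 0 <= a j <= 1, forall j, a j * M j <= 2 ^+ j & unbounded_sums a].
Proof.
move=> l0 lu /(dyadic_majorant l0)[M [D [D0 M0 lM MD]]].
exists (fun j => Num.min 1 (2 ^+ j / M j)), M; split => // [j|j|].
- by rewrite ge_min lexx le_min ler01 divr_ge0// ltW.
- by rewrite -ler_pdivlMr// ge_min lexx orbT.
apply: unbounded_sums_min1 => [j|B]; first by rewrite divr_ge0// ltW.
(* The target is the bound of [blocks] with the condensed sum replaced by B; the terms n < 4 precede
   the first block. *)
have [N hN] := lu (4 * D * B + \sum_(n < 4) (lambda n)^-1); exists N.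
have inv0 n : 0 <= (lambda n)^-1 by rewrite invr_ge0 ltW.
(* Cauchy condensation: the block from 2^(J+2) to 2^(J+3) has 4 * 2^J terms, each at most D / M
   J. *)
have blocks J : \sum_(n < 2 ^ J.+2) (lambda n)^-1 <=
    \sum_(n < 4) (lambda n)^-1 + 4 * D * \sum_(j < J) 2 ^+ j / M j.
  elim: J => [|J IH]; first by rewrite big_ord0 mulr0 addr0.
  rewrite [in leLHS]expnS mul2n -addnn big_split_ord /=.
  rewrite [X in _ * X]big_ord_recr /= mulrDr addrA.
  apply: lerD => //.
  apply: (@le_trans _ _ (\sum_(i < 2 ^ J.+2) (D / M J))).
    apply: ler_sum => i _; rewrite ler_pdivlMr// ler_pdivrMl//= mulrC MD//.
    by rewrite leq_addr /= [X in (_ < X)%N]expnS mul2n -addnn ltn_add2l.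
  rewrite sumr_const card_ord -[leLHS]mulr_natl natrX !exprS.
  by rewrite le_eqVlt; apply/orP; left; apply/eqP; ring.
have NN : (N <= 2 ^ N.+2)%N.
  apply: (leq_trans (ltnW (ltn_expl N (isT : (1 < 2)%N)))).
  by rewrite leq_exp2l//; lia.
have := le_trans hN (le_trans _ (blocks N)).
rewrite -(subnKC NN) big_split_ord /= lerDl sumr_ge0// => /(_ isT).
by rewrite addrC lerD2l ler_pM2l// mulr_gt0.
Qed.

(** * Integration on the circle *)

(** For z = e^(i theta), [cosz n z] is cos(n theta) and [sinz n z] is sin(n theta); powers of z
    avoid choosing an argument. *)
Definition cosz (R : realType) n (z : circle R) : R := complex.Re (val z ^+ n).
Definition sinz (R : realType) n (z : circle R) : R := complex.Im (val z ^+ n).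

Lemma coszD (R : realType) m n (z : circle R) :
  cosz (m + n) z = cosz m z * cosz n z - sinz m z * sinz n z.
Proof. by rewrite /cosz /sinz exprD; case: (_ ^+ m) => a b; case: (_ ^+ n). Qed.

Lemma sinzD (R : realType) m n (z : circle R) :
  sinz (m + n) z = cosz m z * sinz n z + sinz m z * cosz n z.
Proof. by rewrite /cosz /sinz exprD; case: (_ ^+ m) => a b; case: (_ ^+ n). Qed.

Lemma normc_circle (R : realType) (z : circle R) : normc (val z) = 1.
Proof. exact/eqP/(valP z). Qed.

Lemma cosz2Dsinz2 (R : realType) n (z : circle R) :
  cosz n z ^+ 2 + sinz n z ^+ 2 = 1.
Proof.
have : normc (val z ^+ n) ^+ 2 = 1 by rewrite normcX normc_circle !expr1n.
rewrite /cosz /sinz; case: (_ ^+ n) => a b /=.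
by rewrite sqr_sqrtr// addr_ge0 ?sqr_ge0.
Qed.

Lemma normr_cosz_le1 (R : realType) n (z : circle R) : `|cosz n z| <= 1.
Proof.
by rewrite -(@expr_le1 _ 2)// real_normK ?num_real// -(cosz2Dsinz2 n z) lerDl sqr_ge0.
Qed.

Lemma normr_sinz_le1 (R : realType) n (z : circle R) : `|sinz n z| <= 1.
Proof.
by rewrite -(@expr_le1 _ 2)// real_normK ?num_real// -(cosz2Dsinz2 n z) lerDr sqr_ge0.
Qed.

Lemma cosz0 (R : realType) (z : circle R) : cosz 0 z = 1.
Proof. by rewrite /cosz expr0. Qed.

Lemma sinz0 (R : realType) (z : circle R) : sinz 0 z = 0.
Proof. by rewrite /sinz expr0. Qed.

Lemma expi2piX (R : realType) n (t : R) :
  val (expi2pi t) ^+ n = (cos (n%:R * (2 * pi * t)) +i* sin (n%:R * (2 * pi * t)))%C.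
Proof.
elim: n => [|n IH]; first by rewrite expr0 mul0r cos0 sin0.
rewrite exprSr IH -[n.+1%:R]natr1 [(n%:R + 1) * _]mulrDl mul1r cosD sinD.
by congr Complex; rewrite /= addrC.
Qed.

Lemma cosz_expi2pi (R : realType) n (t : R) :
  cosz n (expi2pi t) = cos (n%:R * (2 * pi * t)).
Proof. by rewrite /cosz expi2piX. Qed.

Lemma sinz_expi2pi (R : realType) n (t : R) :
  sinz n (expi2pi t) = sin (n%:R * (2 * pi * t)).
Proof. by rewrite /sinz expi2piX. Qed.

Lemma measurable_circle_coords (R : realType) :
  measurable_fun setT (@circle_coords R).
Proof. by move=> _ B mB; rewrite setTI; exists B => //; rewrite setTI. Qed.

Lemma measurable_cosz_sinz (R : realType) n :
  measurable_fun setT (@cosz R n) /\ measurable_fun setT (@sinz R n).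
Proof.
have m1 : measurable_fun setT (@cosz R 1).
  exact: (measurableT_comp measurable_fst (@measurable_circle_coords R)).
have m2 : measurable_fun setT (@sinz R 1).
  exact: (measurableT_comp measurable_snd (@measurable_circle_coords R)).
elim: n => [|n [IHc IHs]].
  split; [rewrite (_ : cosz 0 = cst 1)|rewrite (_ : sinz 0 = cst 0)] => //;
  by apply/funext => z; rewrite (cosz0, sinz0).
split.
  rewrite (_ : cosz n.+1 = (fun z => cosz n z * cosz 1 z - sinz n z * sinz 1 z)).
    by apply: measurable_funB; exact: measurable_funM.
  by apply/funext => z; rewrite -coszD addn1.
rewrite (_ : sinz n.+1 = (fun z => cosz n z * sinz 1 z + sinz n z * cosz 1 z)).
  by apply: measurable_funD; exact: measurable_funM.
by apply/funext => z; rewrite -sinzD addn1.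
Qed.

Lemma measurable_cosz (R : realType) n : measurable_fun setT (@cosz R n).
Proof. exact: (measurable_cosz_sinz R n).1. Qed.

Lemma measurable_sinz (R : realType) n : measurable_fun setT (@sinz R n).
Proof. exact: (measurable_cosz_sinz R n).2. Qed.
#[local] Hint Resolve measurable_cosz measurable_sinz : core.

Lemma integrable_bounded_circle (R : realType) (h : circle R -> R) (M : R) :
  measurable_fun setT h -> (forall z, `|h z| <= M) ->
  (@arc_length R).-integrable setT (EFin \o h).
Proof.
move=> mh hM; apply: measurable_bounded_integrable => //.
  by rewrite [X in (X < _)%E](arc_length_setT R) ltry.
by exists M; split; [exact: num_real|move=> x Mx z _; apply: le_trans (ltW Mx)].
Qed.

(** Change of variables for the pushforward; the null endpoint 1 is added so that the fundamental
    theorem of calculus applies on a closed interval. *)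
Lemma integral_arc_length (R : realType) (h : circle R -> R) (M : R) :
  measurable_fun setT h -> (forall z, `|h z| <= M) ->
  (\int[@arc_length R]_z (h z)%:E =
   \int[lebesgue_measure]_(t in `[0%R, 1%R]) (h (expi2pi t))%:E)%E.
Proof.
move=> mh hM.
have mhe : measurable_fun setT (fun t : R => (h (expi2pi t))%:E).
  by apply/measurable_EFinP; apply: measurableT_comp => //; exact: measurable_expi2pi.
have m01 : measurable (`[0, 1[ : set R) by [].
pose nu : {measure set (measurableTypeR R) -> \bar R} := mrestr (@lebesgue_measure R) m01.
have ih : nu.-integrable setT (EFin \o (h \o @expi2pi R)).
  apply: measurable_bounded_integrable => //.
  + by rewrite /nu /= /mrestr setTI lebesgue_measure_itv/= lte_fin ltr01 oppr0 adde0 ltry.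
  + by apply: measurableT_comp => //; exact: measurable_expi2pi.
  + by exists M; split; [exact: num_real|move=> x Mx z _; exact: le_trans (hM _) (ltW Mx)].
rewrite (@integral_pushforward _ _ (measurableTypeR R) _ _ _ (@measurable_expi2pi R)
  nu setT (EFin \o h)) ?preimage_setT//; last exact/measurable_EFinP.
rewrite (@negligible_integral _ _ _ nu setT (~` `[0, 1[))//; last 2 first.
- exact: measurableC.
- by rewrite /nu /= /mrestr setICl measure0.
rewrite setTD setCK (@eq_measure_integral _ _ _ _ (@lebesgue_measure R)).
  by rewrite integral_itv_bndo_bndc//; exact: measurable_funTS.
by move=> A mA A01; rewrite /nu /= /mrestr setIidl.
Qed.

Lemma expi2pi1X (R : realType) n : (val (@expi2pi R 1)) ^+ n = 1.
Proof. by rewrite /= mulr1 mulrC mulr_natr cos2pi sin2pi expr1n. Qed.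

Lemma integral01_derivative (R : realType) (F f : R -> R) :
  (forall t : R, is_derive t (1 : R) F (f t)) -> continuous f -> F 0 = F 1 ->
  (\int[lebesgue_measure]_(t in `[0%R, 1%R]) (f t)%:E = 0)%E.
Proof.
move=> dF cf F01.
have cF : continuous F.
  by move=> t; apply: differentiable_continuous; apply/derivable1_diffP/ex_derive.
rewrite (@continuous_FTC2 _ f F)//.
- by rewrite -EFinB F01 subrr.
- exact: continuous_subspaceT.
- split => [t _||]; first exact/ex_derive.
  + by apply: cvg_at_right_filter; exact: cF.
  + by apply: cvg_at_left_filter; exact: cF.
- by move=> t _; rewrite derive1E derive_val.
Qed.

Lemma integral_cosz (R : realType) n : (0 < n)%N ->
  (\int[@arc_length R]_z cosz n z = 0)%R.
Proof.
move=> n0; rewrite /Rintegral (integral_arc_length _ (@normr_cosz_le1 R n))//.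
under eq_integral do rewrite cosz_expi2pi.
pose c : R := n%:R * (2 * pi).
have c0 : c != 0 by rewrite !mulf_neq0 ?gt_eqF ?pi_gt0 ?ltr0n.
have cE t : n%:R * (2 * pi * t) = c * t by rewrite /c; ring.
have dF (t : R) : is_derive t (1 : R) (fun t => c^-1 * sin (c * t))
    (cos (n%:R * (2 * pi * t))).
  rewrite cE; apply: is_derive_eq.
  by rewrite /GRing.scale /=; field.
rewrite (integral01_derivative dF)//.
- move=> t; apply: continuous_comp; last exact: continuous_cos.
  by apply: cvgM; [exact: cvg_cst | apply: cvgM; [exact: cvg_cst | exact: cvg_id]].
- by rewrite mulr0 sin0 -cE -sinz_expi2pi /sinz expi2pi1X.
Qed.

Lemma integral_sinz (R : realType) n : (\int[@arc_length R]_z sinz n z = 0)%R.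
Proof.
rewrite /Rintegral (integral_arc_length _ (@normr_sinz_le1 R n))//.
under eq_integral do rewrite sinz_expi2pi.
have [->|n0] := posnP n.
  by under eq_integral do rewrite mul0r sin0; rewrite integral0.
pose c : R := n%:R * (2 * pi).
have c0 : c != 0 by rewrite !mulf_neq0 ?gt_eqF ?pi_gt0 ?ltr0n.
have cE t : n%:R * (2 * pi * t) = c * t by rewrite /c; ring.
have dF (t : R) : is_derive t (1 : R) (fun t => - c^-1 * cos (c * t))
    (sin (n%:R * (2 * pi * t))).
  rewrite cE; apply: is_derive_eq.
  by rewrite /GRing.scale /=; field.
rewrite (integral01_derivative dF)//.
- move=> t; apply: continuous_comp; last exact: continuous_sin.
  by apply: cvgM; [exact: cvg_cst | apply: cvgM; [exact: cvg_cst | exact: cvg_id]].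
- by rewrite mulr0 cos0 -cE -cosz_expi2pi /cosz expi2pi1X.
Qed.

(** The hypothesis n <= m makes m - n a true difference. Its addition formulas come from expanding m
    = (m - n) + n and using cos^2 + sin^2 = 1. *)
Lemma cosz_sinz_mul (R : realType) m n (z : circle R) : (n <= m)%N ->
  [/\ cosz m z * cosz n z = 2^-1 * (cosz (m + n) z + cosz (m - n) z),
      cosz m z * sinz n z = 2^-1 * (sinz (m + n) z - sinz (m - n) z) &
      cosz n z * sinz m z = 2^-1 * (sinz (m + n) z + sinz (m - n) z)].
Proof.
move=> nm; rewrite coszD sinzD.
have -> : cosz (m - n) z = cosz m z * cosz n z + sinz m z * sinz n z.
  rewrite -[in RHS](subnK nm) coszD sinzD.
  rewrite -[LHS]mul1r -(cosz2Dsinz2 n z); ring.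
have -> : sinz (m - n) z = sinz m z * cosz n z - cosz m z * sinz n z.
  rewrite -[in RHS](subnK nm) coszD sinzD.
  rewrite -[LHS]mul1r -(cosz2Dsinz2 n z); ring.
by split; field.
Qed.

Lemma integrable_cosz (R : realType) n :
  (@arc_length R).-integrable setT (EFin \o cosz n).
Proof. exact: (integrable_bounded_circle _ (@normr_cosz_le1 R n)). Qed.

Lemma integrable_sinz (R : realType) n :
  (@arc_length R).-integrable setT (EFin \o sinz n).
Proof. exact: (integrable_bounded_circle _ (@normr_sinz_le1 R n)). Qed.

Lemma normr_integral_circle_le (R : realType) (h : circle R -> R) (M : R) :
  measurable_fun setT h -> (forall z, `|h z| <= M) ->
  `|\int[@arc_length R]_z h z| <= M.
Proof.
move=> mh hM; have ih := integrable_bounded_circle mh hM.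
apply: le_trans (le_normr_Rintegral _ ih) _ => //.
have -> : M = \int[@arc_length R]_z M.
  by rewrite Rintegral_cst//= [X in fine X](arc_length_setT R) mulr1.
apply: le_Rintegral => //.
- exact: (integrable_norm ih).
- apply: (@integrable_bounded_circle _ (cst M) `|M|) => //.
Qed.

(** Orthogonality as an upper bound: it covers at once the diagonal value 1/2 and the value 1 at
    frequency 0. *)
Lemma integral_cosz_cosz (R : realType) m n :
  `|\int[@arc_length R]_z (cosz m z * cosz n z)| <= (m == n)%:R.
Proof.
wlog nm : m n / (n <= m)%N.
  move=> h; case: (leqP n m) => [/h//|/ltnW /h].
  by rewrite eq_sym; under eq_Rintegral do rewrite mulrC.
have [->|mn] := eqVneq m n.
  apply: normr_integral_circle_le; first exact: measurable_funM.
  by move=> z; rewrite normrM mulr_ile1 ?normr_cosz_le1.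
have {mn}nm' : (n < m)%N by rewrite ltn_neqAle eq_sym mn.
under eq_Rintegral => z _ do have [-> _ _] := cosz_sinz_mul z nm.
rewrite RintegralZl//; last first.
  apply: (@integrable_bounded_circle _ _ 2); first exact: measurable_funD.
  move=> z; apply: (le_trans (ler_normD _ _)).
  by rewrite (_ : 2 = 1 + 1)// lerD ?normr_cosz_le1.
rewrite RintegralD ?integrable_cosz//.
by rewrite !integral_cosz ?subn_gt0 ?addn_gt0 ?(leq_ltn_trans _ nm')// addr0 mulr0 normr0.
Qed.

Lemma integral_cosz_sinz (R : realType) m n :
  (\int[@arc_length R]_z (cosz m z * sinz n z) = 0)%R.
Proof.
have i2 (h : circle R -> R) : measurable_fun setT h ->
    (forall z, `|h z| <= 1 + 1) -> (@arc_length R).-integrable setT (EFin \o h).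
  exact: integrable_bounded_circle.
case: (leqP n m) => [nm|/ltnW nm].
  under eq_Rintegral => z _ do have [_ -> _] := cosz_sinz_mul z nm.
  rewrite RintegralZl//; last first.
    apply: i2; first exact: measurable_funB.
    by move=> z; apply: (le_trans (ler_normB _ _)); rewrite lerD ?normr_sinz_le1.
  by rewrite RintegralB ?integrable_sinz// !integral_sinz subrr mulr0.
under eq_Rintegral => z _ do have [_ _ ->] := cosz_sinz_mul z nm.
rewrite RintegralZl//; last first.
  apply: i2; first exact: measurable_funD.
  by move=> z; apply: (le_trans (ler_normD _ _)); rewrite lerD ?normr_sinz_le1.
by rewrite RintegralD ?integrable_sinz// !integral_sinz addr0 mulr0.
Qed.

Section cos_poly_circle.
Variables (R : realType) (c : nat -> R) (L : nat).
Hypothesis c_ge0 : forall n, 0 <= c n.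
Let P (z : circle R) : R := cos_poly c L (val z).

Lemma measurable_cos_poly : measurable_fun setT P.
Proof.
have m n : measurable_fun setT (fun z : circle R => c n * cosz n z).
  exact: measurable_funM.
by apply: (measurable_sum (index_enum _)
  (h := fun (n : 'I_L) (z : circle R) => c n * cosz n z)).
Qed.

Lemma normr_cos_poly_le z : `|P z| <= \sum_(n < L) c n.
Proof.
apply: le_trans (ler_norm_sum _ _ _) _; apply: ler_sum => n _.
by rewrite normrM ger0_norm// ler_piMr// normr_cosz_le1.
Qed.

Lemma integral_cos_polyM (h : circle R -> R) : measurable_fun setT h ->
  (forall z, `|h z| <= 1) ->
  (\int[@arc_length R]_z (P z * h z) =
   \sum_(n < L) c n * \int[@arc_length R]_z (cosz n z * h z))%R.
Proof.
move=> mh h1.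
have ich n : (@arc_length R).-integrable setT (EFin \o (fun z => cosz n z * h z)).
  apply: (@integrable_bounded_circle _ _ 1); first exact: measurable_funM.
  by move=> z; rewrite normrM mulr_ile1 ?normr_cosz_le1.
have icch n : (@arc_length R).-integrable setT (EFin \o (fun z => c n * (cosz n z * h z))).
  exact: (integrableZl measurableT (c n) (ich n)).
rewrite /Rintegral.
under eq_integral => z _ do
  rewrite /P /cos_poly mulr_suml -sumEFin
    (eq_bigr _ (fun i _ => congr1 _ (esym (mulrA _ _ _)))).
rewrite integral_sum//; last by move=> n; exact: icch.
suff -> : (\sum_(n < L) \int[@arc_length R]_z (c n * (cosz n z * h z))%:E)%E =
    (\sum_(n < L) c n * \int[@arc_length R]_z (cosz n z * h z))%:E by [].
rewrite -sumEFin; apply: eq_bigr => n _.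
rewrite -RintegralZl// /Rintegral fineK//.
exact: (integrable_fin_num measurableT (icch n)).
Qed.

(** By orthogonality only the n-th coefficient of P survives. *)
Lemma normr_integral_cos_poly_cosz n :
  `|\int[@arc_length R]_z (P z * cosz n z)| <= if (n < L)%N then c n else 0.
Proof.
rewrite integral_cos_polyM//; last by move=> z; exact: normr_cosz_le1.
apply: (@le_trans _ _ (\sum_(m < L) c m * ((m : nat) == n)%:R)).
  apply: le_trans (ler_norm_sum _ _ _) _; apply: ler_sum => m _.
  by rewrite normrM ger0_norm// ler_wpM2l// integral_cosz_cosz.
case: ltnP => nL; last first.
  by rewrite big1// => m _; rewrite ltn_eqF ?mulr0// (leq_trans (ltn_ord m)).
rewrite (bigD1 (Ordinal nL))//= eqxx mulr1 big1 ?addr0// => m.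
by rewrite -val_eqE /= => /negbTE ->; rewrite mulr0.
Qed.

(** P has no sine terms; [s] will be the sign of the imaginary part of z^-n. *)
Lemma integral_cos_poly_sinz (s : R) n : `|s| <= 1 ->
  (\int[@arc_length R]_z (P z * (s * sinz n z)) = 0)%R.
Proof.
move=> s1; rewrite integral_cos_polyM; last 2 first.
- exact: measurable_funM.
- by move=> z; rewrite normrM mulr_ile1 ?normr_sinz_le1.
rewrite big1// => m _.
under eq_Rintegral do rewrite mulrCA.
rewrite RintegralZl// ?integral_cosz_sinz ?mulr0//.
apply: (@integrable_bounded_circle _ _ 1); first exact: measurable_funM.
by move=> z; rewrite normrM mulr_ile1 ?normr_cosz_le1 ?normr_sinz_le1.
Qed.

(* A nonnegative P satisfies P^2 <= P(1) P, and P has mean c 0. *)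
Lemma integral_sqr_cos_poly : (forall z, 0 <= P z) ->
  (\int[@arc_length R]_z (P z ^+ 2)%:E <=
   ((if (0 < L)%N then c 0%N else 0) * \sum_(n < L) c n)%:E)%E.
Proof.
move=> P0; have mP := measurable_cos_poly.
set s := \sum_(n < L) c n.
have iP : (@arc_length R).-integrable setT (EFin \o P).
  exact: integrable_bounded_circle normr_cos_poly_le.
apply: (@le_trans _ _ (\int[@arc_length R]_z (s * P z)%:E)%E).
  apply: ge0_le_integral => //.
  - by move=> z _; rewrite lee_fin sqr_ge0.
  - by apply/measurable_EFinP; exact: measurable_funX.
  - by apply/measurable_EFinP; exact: measurable_funM.
  move=> z _; rewrite lee_fin expr2 ler_wpM2r//.
  exact: le_trans (ler_norm _) (normr_cos_poly_le z).
have isP : (@arc_length R).-integrable setT (EFin \o (fun z => s * P z)).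
  exact: (integrableZl measurableT s iP).
rewrite -(fineK (integrable_fin_num measurableT isP)) lee_fin.
rewrite -[leLHS]/(Rintegral _ _ _) RintegralZl// mulrC.
rewrite ler_wpM2r ?sumr_ge0//; apply: le_trans (normr_integral_cos_poly_cosz 0).
apply: le_trans (ler_norm _); rewrite le_eqVlt; apply/orP; left; apply/eqP.
by apply: eq_Rintegral => z _; rewrite cosz0 mulr1.
Qed.

End cos_poly_circle.

(** * Square-summable series of nonnegative functions *)

(** Cauchy-Schwarz with weights 2^-(k+1), obtained by iterating (x + s)^2 <= 2 x^2 + 2 s^2. *)
Lemma sqr_sum_le (R : realFieldType) (x : nat -> R) K :
  (\sum_(k < K) x k) ^+ 2 <= \sum_(k < K) 2 ^+ k.+1 * x k ^+ 2.
Proof.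
elim: K x => [|K IH] x; first by rewrite !big_ord0 expr0n.
rewrite !big_ord_recl /= expr1; set s := \sum_(i < K) _.
have := IH (fun i => x i.+1); rewrite -/s => hs.
have -> : \sum_(i < K) 2 ^+ (bump 0 i).+1 * x (bump 0 i) ^+ 2 =
    2 * \sum_(i < K) 2 ^+ i.+1 * x i.+1 ^+ 2.
  by rewrite mulr_sumr; apply: eq_bigr => i _; rewrite mulrA -exprS.
have : 0 <= (x 0%N - s) ^+ 2 by exact: sqr_ge0.
nra.
Qed.

Section L2_series.
Context d (T : measurableType d) (R : realType).
Variables (mu : {measure set T -> \bar R}) (g : nat -> T -> R) (E : nat -> R) (B : R).
Hypothesis mg : forall k, measurable_fun setT (g k).
Hypothesis g_ge0 : forall k z, 0 <= g k z.
Hypothesis g0_ge1 : forall z, 1 <= g 0%N z.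
Hypothesis gE : forall k, (\int[mu]_z (g k z ^+ 2)%:E <= (E k)%:E)%E.
Hypothesis EB : forall K, \sum_(k < K) 2 ^+ k.+1 * E k <= B.

Let S K z := \sum_(k < K) g k z.
Let G z := (\sum_(0 <= k <oo) (g k z)%:E)%E.
(** The integrable majorant: by [sqr_sum_le] it dominates every squared partial sum, and its
    integral is at most B. *)
Let Q z := (\sum_(0 <= k <oo) (2 ^+ k.+1 * g k z ^+ 2)%:E)%E.
(* [fine +oo = 0], so f takes the value 1 where the series diverges. *)
Let f z := Num.max 1 (fine (G z)).

Let G_term k z : (0 <= (g k z)%:E)%E. Proof. by rewrite lee_fin. Qed.

Let Q_term k z : (0 <= (2 ^+ k.+1 * g k z ^+ 2)%:E)%E.
Proof. by rewrite lee_fin mulr_ge0 ?sqr_ge0 ?exprn_ge0. Qed.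

Let mG : measurable_fun setT G.
Proof.
apply: (@emeasurable_fun_cvg _ _ _ _ (fun K z => \sum_(0 <= k < K) (g k z)%:E)%E).
  by move=> K; apply: emeasurable_sum => k; exact/measurable_EFinP.
by move=> z _; apply: is_cvg_nneseries => k _ _.
Qed.

Let mQ : measurable_fun setT Q.
Proof.
apply: (@emeasurable_fun_cvg _ _ _ _
  (fun K z => \sum_(0 <= k < K) (2 ^+ k.+1 * g k z ^+ 2)%:E)%E).
  move=> K; apply: emeasurable_sum => k; apply/measurable_EFinP.
  by apply: measurable_funM => //; exact: measurable_funX.
by move=> z _; apply: is_cvg_nneseries => k _ _.
Qed.

Let mf : measurable_fun setT f.
Proof.
apply: measurable_maxr => //; apply: measurableT_comp => //.
Qed.

Let S_ge0 K z : 0 <= S K z. Proof. exact: sumr_ge0. Qed.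

Let S_le_Q K z : (((S K z) ^+ 2)%:E <= Q z)%E.
Proof.
apply: (@le_trans _ _ (\sum_(0 <= k < K) (2 ^+ k.+1 * g k z ^+ 2)%:E)%E).
  by rewrite sumEFin lee_fin big_mkord; exact: (sqr_sum_le (g ^~ z)).
by apply: nneseries_lim_ge => k _ _.
Qed.

(** A nonempty partial sum contains g 0 >= 1. Thus Q dominates the partial sums themselves and not
    only their squares. *)
Let S_le_sqr K z : S K z <= S K z ^+ 2.
Proof.
case: K => [|K]; first by rewrite /S big_ord0 expr0n.
rewrite expr2 ler_peMl//; rewrite /S big_ord_recl /=.
by rewrite ler_wpDr ?sumr_ge0.
Qed.

Let G_fin z : Q z \is a fin_num -> G z \is a fin_num.
Proof.
move=> /fin_numPlt /andP[_ Qfin].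
rewrite ge0_fin_numE; last by apply: nneseries_ge0.
apply: le_lt_trans Qfin; apply: lime_le; first exact: is_cvg_nneseries.
apply: nearW => K; rewrite sumEFin big_mkord; apply: le_trans (S_le_Q K z).
by rewrite lee_fin; exact: S_le_sqr.
Qed.

Let S_cvg z : G z \is a fin_num -> S ^~ z @ \oo --> fine (G z).
Proof.
move=> Gfin.
have /fine_cvg : (\sum_(0 <= k < K) (g k z)%:E)%E @[K --> \oo] --> (fine (G z))%:E.
  by rewrite fineK//; apply: is_cvg_nneseries.
apply: cvg_trans; apply: near_eq_cvg; apply: nearW => K.
by rewrite /= sumEFin /= big_mkord.
Qed.

Let S_le_G K z : G z \is a fin_num -> S K z <= fine (G z).
Proof.
move=> Gfin; rewrite -lee_fin fineK// /S -(big_mkord predT (fun k => g k z)) -sumEFin.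
by apply: nneseries_lim_ge => k _ _.
Qed.

Let fE z : G z \is a fin_num -> f z = fine (G z).
Proof.
move=> Gfin; apply/max_idPr; apply: le_trans (S_le_G 1 Gfin).
by rewrite /S big_ord1.
Qed.

(** Where G is finite this is the limit of [S_le_Q]; elsewhere f = 1, and already the first partial
    sum is at least 1. *)
Let sqr_f_le z : ((f z ^+ 2)%:E <= Q z)%E.
Proof.
have [Gfin|Ginf] := boolP (G z \is a fin_num).
  have [Qy|Qfin] := eqVneq (Q z) +oo%E; first by rewrite Qy leey.
  have {}Qfin : Q z \is a fin_num.
    by rewrite ge0_fin_numE ?lt_neqAle ?Qfin ?leey//; apply: nneseries_ge0.
  rewrite fE// -(fineK Qfin) lee_fin.
  have SS : S ^~ z K ^+ 2 @[K --> \oo] --> fine (G z) ^+ 2.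
    by rewrite expr2; apply: cvgM; exact: S_cvg.
  rewrite -(cvg_lim _ SS)//; apply: limr_le; first by apply/cvg_ex; exists (fine (G z) ^+ 2).
  by apply: nearW => K; rewrite -lee_fin fineK.
have -> : f z = 1.
  by apply/max_idPl; case: (G z) Ginf => //= r; rewrite ?ler01.
apply: le_trans (S_le_Q 1 z); rewrite expr1n lee_fin.
by rewrite expr_ge1 /S ?big_ord1.
Qed.

Let int_Q_fin : (\int[mu]_z Q z < +oo)%E.
Proof.
rewrite integral_nneseries//; last first.
  move=> k; apply/measurable_EFinP.
  by apply: measurable_funM => //; exact: measurable_funX.
apply: (@le_lt_trans _ _ B%:E); last exact: ltry.
apply: lime_le.
  by apply: is_cvg_nneseries => k _ _; exact: integral_ge0.
apply: nearW => K; rewrite big_mkord.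
apply: (@le_trans _ _ (\sum_(k < K) (2 ^+ k.+1 * E k)%:E)%E).
  apply: lee_sum => k _; under eq_integral do rewrite EFinM.
  rewrite ge0_integralZl//; first by rewrite EFinM lee_wpmul2l ?lee_fin ?exprn_ge0.
  - by apply/measurable_EFinP; exact: measurable_funX.
  - by move=> z _; rewrite lee_fin sqr_ge0.
by rewrite sumEFin lee_fin.
Qed.

Let Q_ge0 z : (0 <= Q z)%E. Proof. exact: nneseries_ge0. Qed.

Let int_Q : mu.-integrable setT Q.
Proof.
apply/integrableP; split => //.
by under eq_integral => z _ do rewrite gee0_abs//.
Qed.

Let G_fin_ae : {ae mu, forall z, G z \is a fin_num}.
Proof.
by apply: filterS (integrable_ae measurableT int_Q) => z /(_ I) /G_fin.
Qed.

(** For |h| <= 1, |S_K h| <= S_K <= S_K^2 <= Q, so dominated convergence applies. Taking cosines and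
    sines for h yields the Fourier coefficients of f. *)
Lemma exists_L2_sum : exists f : T -> R,
  [/\ forall z, 0 < f z, f \in Lfun mu 2%:E,
      {ae mu, forall z k, g k z <= f z} &
      forall h : T -> R, measurable_fun setT h -> (forall z, `|h z| <= 1) ->
        (\sum_(k < K) \int[mu]_z (g k z * h z)) @[K --> \oo] -->
        (\int[mu]_z (f z * h z))%R].
Proof.
exists f; split.
- by move=> z; rewrite lt_max ltr01.
- rewrite inE; apply/andP; split; rewrite inE//= /finite_norm unlock poweR_lty//.
  apply: le_lt_trans int_Q_fin; apply: ge0_le_integral => //.
  + by move=> z _; rewrite poweR_ge0.
  + rewrite [X in measurable_fun _ X](_ : _ = fun z => ((f z) ^+ 2)%:E).
      by apply/measurable_EFinP; exact: measurable_funX.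
    by apply/funext => z /=; rewrite powR_mulrn// real_normK// num_real.
  + by move=> z _ /=; rewrite powR_mulrn// real_normK ?num_real.
- apply: filterS G_fin_ae => z Gfin k; rewrite fE//; apply: le_trans (S_le_G k.+1 Gfin).
  by rewrite /S big_ord_recr /= lerDr sumr_ge0.
- move=> h mh h1.
  have mgh k : measurable_fun setT (fun z => g k z * h z) by exact: measurable_funM.
  have Sh_le K z : (`|(S K z * h z)%:E| <= Q z)%E.
    apply: le_trans (S_le_Q K z); rewrite lee_fin normrM ger0_norm//.
    by apply: le_trans (S_le_sqr K z); rewrite ler_piMr.
  have mSh K : measurable_fun setT (fun z => (S K z * h z)%:E).
    by apply/measurable_EFinP; apply: measurable_funM => //; exact: measurable_sum.
  have mfh : measurable_fun setT (fun z => (f z * h z)%:E).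
    by apply/measurable_EFinP; exact: measurable_funM.
  have cvfh : {ae mu, forall z, setT z -> (S K z * h z)%:E @[K --> \oo] --> (f z * h z)%:E}.
    apply: filterS G_fin_ae => z Gfin _; apply: cvg_EFin; first exact: nearW.
    by apply: cvgM; [rewrite fE//; exact: S_cvg | exact: cvg_cst].
  have dom : {ae mu, forall z K, setT z -> (`|(S K z * h z)%:E| <= Q z)%E}.
    by apply: aeW => z K _.
  have [ifh _ cv] := dominated_convergence measurableT mSh mfh cvfh int_Q dom.
  have igh k : mu.-integrable setT (fun z => (g k z * h z)%:E).
    apply: (le_integrable measurableT _ _ int_Q); first exact/measurable_EFinP.
    move=> z _; rewrite (gee0_abs (Q_ge0 z)); apply: le_trans (S_le_Q k.+1 z).
    rewrite lee_fin normrM ger0_norm//; apply: le_trans (S_le_sqr k.+1 z).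
    apply: (@le_trans _ _ (g k z)); first by rewrite ler_piMr.
    by rewrite /S big_ord_recr /= lerDr sumr_ge0.
  have /fine_cvg : (\int[mu]_z (S K z * h z)%:E)%E @[K --> \oo] --> (\int[mu]_z (f z * h z))%:E.
    by rewrite fineK ?integrable_fin_num.
  apply: cvg_trans; apply: near_eq_cvg; apply: nearW => K /=.
  under eq_integral do rewrite mulr_suml -sumEFin.
  rewrite integral_sum//.
  suff -> : (\sum_(k < K) \int[mu]_z (g k z * h z)%:E)%E =
    (\sum_(k < K) (\int[mu]_z (g k z * h z))%R)%:E by [].
  rewrite -sumEFin; apply: eq_bigr => k _.
  by rewrite fineK//; exact: (integrable_fin_num measurableT (igh k)).
Qed.

End L2_series.

(** * Local unboundedness *)

Lemma expi2piD1 (R : realType) (t : R) : expi2pi (t + 1) = expi2pi t.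
Proof.
apply: val_inj; rewrite /= mulrDr mulr1.
by rewrite [2 * pi]mulrC mulr_natr cosD2pi sinD2pi.
Qed.

Lemma expi2piDn (R : realType) (t : R) (n : nat) : expi2pi (t + n%:R) = expi2pi t.
Proof.
by elim: n => [|n IH]; rewrite ?addr0// -natr1 addrA expi2piD1.
Qed.

Lemma expi2piDz (R : realType) (t : R) (m : int) : expi2pi (t + m%:~R) = expi2pi t.
Proof.
case: m => n; first exact: expi2piDn.
by rewrite NegzE mulrNz -[LHS](expi2piDn _ n.+1) subrK.
Qed.

(** Periodicity moves the starting parameter into [0, 1[ by subtracting the floor of a; cutting at 1
    keeps a nondegenerate subinterval. *)
Lemma open_arc_itv01 (R : realType) (a b : R) : a < b ->
  exists a' b' : R, [/\ 0 <= a', a' < b', b' <= 1 &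
    forall t, a' < t < b' -> open_arc a b (expi2pi t)].
Proof.
move=> ab; pose s : R := (Num.floor a)%:~R.
have s_le : s <= a by exact: floor_le.
have s_gt : a < s + 1 by have /andP[_] := floor_itv a; rewrite intrD.
exists (a - s), (Num.min b (s + 1) - s); split.
- by rewrite subr_ge0.
- by rewrite ltrD2r lt_min ab.
- by rewrite lerBlDl ge_min lexx orbT.
- move=> t /andP[at_ tb]; exists (t + s); last by rewrite /s expi2piDz.
  rewrite /= in_itv /= -ltrBlDr at_ /=.
  by move: tb; rewrite ltrBrDr lt_min => /andP[].
Qed.

Lemma exists_dyadic (R : realType) (a b : R) k : 0 <= a -> (2 ^+ k)^-1 < b - a ->
  exists j : nat, a < j%:R / 2 ^+ k < b.
Proof.
move=> a0 ab; have p0 : 0 < 2 ^+ k :> R by rewrite exprn_gt0.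
have x0 : 0 <= a * 2 ^+ k by rewrite mulr_ge0// ltW.
exists (Num.trunc (a * 2 ^+ k)).+1; apply/andP; split.
  by rewrite ltr_pdivlMr//; exact: truncnS_gt.
rewrite ltr_pdivrMr// -natr1.
have /andP[+ _] := truncn_itv x0.
have : 1 < (b - a) * 2 ^+ k by rewrite -ltr_pdivrMr// div1r.
rewrite mulrBl; lra.
Qed.

Lemma continuous_cos_poly_expi2pi (R : realType) (c : nat -> R) L :
  continuous (fun t : R => cos_poly c L (val (expi2pi t))).
Proof.
rewrite (_ : (fun t => _) =
    (fun t : R => \sum_(n < L) c n * cos (n%:R * (2 * pi * t)))); last first.
  by apply/funext => t; apply: eq_bigr => n _; rewrite expi2piX.
apply: continuous_big => [|n _ t]; first exact: add_continuous.
apply: cvgM; first exact: cvg_cst.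
apply: continuous_comp; last exact: continuous_cos.
by apply: cvgM; [exact: cvg_cst | apply: cvgM; [exact: cvg_cst | exact: cvg_id]].
Qed.

(** As [X] is an arbitrary set, the argument is subadditivity of the Lebesgue outer measure: ]a, b[
    is covered by the preimages of a null set and of X. *)
Lemma arc_length_gt0 (R : realType) (X N : set (circle R)) (a b : R) :
  0 <= a -> a < b -> b <= 1 -> (@arc_length R).-negligible N ->
  (forall t, a < t < b -> ~ N (expi2pi t) -> X (expi2pi t)) ->
  (0 < arc_length X)%E.
Proof.
move=> a0 ab b1 [N' [mN' N'0 NN']] abX.
pose l : set (measurableTypeR R) -> \bar R := (wlength idfun)^*%mu.
have lE Y : lebesgue_measure Y = l Y by [].
have : (l `]a, b[%classic <= l ((@expi2pi R) @^-1` N' `&` `[0%R, 1%R[) +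
                    l ((@expi2pi R) @^-1` X `&` `[0%R, 1%R[))%E.
  apply: le_trans (outer_measureU2 _ _ _); apply: le_outer_measure => t /=.
  rewrite in_itv /= => /andP[at_ tb].
  have t01 : 0 <= t < 1 by rewrite (le_trans a0 (ltW at_)) (lt_le_trans tb b1).
  rewrite in_itv /= t01.
  have [/NN' Nt|Nt] := pselect (N (expi2pi t)); [left|right]; split => //.
  by apply: abX => //; rewrite at_.
rewrite -!lE; move: N'0; rewrite /arc_length /pushforward /mrestr => -> ; rewrite add0e.
apply: lt_le_trans; rewrite lebesgue_measure_itv /= lte_fin ab -EFinB lte_fin.
by rewrite subr_gt0.
Qed.

(** The 2^k-th roots of unity become dense, so a given arc contains one with k >= M. By continuity
    the k-th polynomial exceeds M near that root, and f is above it almost everywhere. *)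
Lemma everywhere_locally_unboundedP (R : realType) (f : circle R -> R)
    (c : nat -> nat -> R) (L : nat -> nat) :
  {ae @arc_length R, forall z k, cos_poly (c k) (L k) (val z) <= f z} ->
  (forall k (w : R[i]), w ^+ (2 ^ k) = 1 -> k%:R < cos_poly (c k) (L k) w) ->
  everywhere_locally_unbounded f.
Proof.
move=> fc cK a b M /open_arc_itv01[a' [b' [a'0 a'b' b'1 abP]]] M0.
have [k Mk kab] : exists2 k, M <= k%:R & (2 ^+ k)^-1 < b' - a'.
  (* One summand gives k >= M; the other, through 2^k > k, makes the mesh 2^-k finer than the
     interval. *)
  pose k := (Num.bound M + Num.bound (b' - a')^-1)%N; exists k.
    by rewrite /k natrD ler_wpDr// ltW// archi_boundP// ltW.
  have ba0 : 0 < b' - a' by rewrite subr_gt0.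
  rewrite invf_plt ?posrE ?exprn_gt0//.
  apply: (@lt_trans _ _ k%:R).
    by rewrite /k natrD ltr_wpDl// archi_boundP// invr_ge0 ltW.
  by rewrite -natrX ltr_nat ltn_expl.
have [j /andP[a'j jb']] := exists_dyadic a'0 kab.
set t0 := j%:R / 2 ^+ k in a'j jb'.
have root : (val (expi2pi t0)) ^+ (2 ^ k) = 1.
  rewrite expi2piX (_ : _ * _ = j%:R * (2 * pi * 1)); last first.
    rewrite natrX /t0; have ? : 2 ^+ k != 0 :> R by rewrite expf_neq0 ?pnatr_eq0.
    by field.
  by rewrite -expi2piX expi2pi1X.
have : \forall t \near t0, M < cos_poly (c k) (L k) (val (expi2pi t)) /\ a' < t < b'.
  near=> t; split.
    near: t; apply: cvgr_gt; first exact: continuous_cos_poly_expi2pi.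
    by apply: le_lt_trans Mk _; exact: cK.
  apply/andP; split; near: t; [exact: lt_nbhsr | exact: lt_nbhsl].
move=> /nbhs_ballP[d /= d0 hd].
have near_in t : t0 - d < t < t0 + d ->
    M < cos_poly (c k) (L k) (val (expi2pi t)) /\ a' < t < b'.
  by move=> td; apply: hd; rewrite /ball /= ltr_distlC.
apply: (@arc_length_gt0 _ _ _ (Num.max a' (t0 - d)) (Num.min b' (t0 + d)) _ _ _ fc).
- by rewrite le_max a'0.
- by rewrite lt_min !gt_max a'b' /=; apply/andP; split; [|apply/andP; split]; lra.
- by rewrite ge_min b'1.
move=> t; rewrite gt_max lt_min => /andP[/andP[a't dt] /andP[tb' td]] Nt.
have [Mc _] := near_in t ltac:(by rewrite dt).
split; first by apply: abP; rewrite a't.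
apply: lt_le_trans (ler_norm _); apply: lt_le_trans Mc _.
by move/contrapT : Nt; apply.
Unshelve. all: by end_near. Qed.

(** * Fourier coefficients *)

(** For n >= 0, z^-n is the conjugate of z^n, so s = -1; for negative n, s = 1. Only |s| <= 1 is
    kept, since the sine integrals will vanish. *)
Lemma exprz_circle (R : realType) (n : int) :
  exists2 s : R, `|s| <= 1 & forall z : circle R,
    val z ^ (- n) = (cosz `|n|%N z +i* (s * sinz `|n|%N z))%C.
Proof.
case: n => n; [exists (-1)|exists 1] => [|z||z]; rewrite ?normrN1 ?normr1//.
  have /unit_circle_conj zc : normc (val z ^+ n) = 1 by rewrite normcX normc_circle expr1n.
  by rewrite -exprnN -zc /cosz /sinz mulN1r [absz _]/=; case: (_ ^+ n).
by rewrite -[_ ^ _]/(val z ^+ n.+1) /cosz /sinz mul1r [absz _]/=; case: (_ ^+ n.+1).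
Qed.

Lemma normc_fourier_coef (R : realType) (f : circle R -> R) (n : int) :
  exists2 s : R, `|s| <= 1 & normc (fourier_coef f n) ^+ 2 =
    (\int[@arc_length R]_z (f z * cosz `|n|%N z)) ^+ 2 +
    (\int[@arc_length R]_z (f z * (s * sinz `|n|%N z))) ^+ 2.
Proof.
have [s s1 sE] := exprz_circle R n; exists s => //.
rewrite /fourier_coef /circle_integral /= sqr_sqrtr ?addr_ge0 ?sqr_ge0//.
congr (_ ^+ 2 + _ ^+ 2); apply: eq_Rintegral => z _; rewrite sE /=.
  by rewrite mul0r subr0.
by rewrite mul0r addr0.
Qed.

Lemma esum_int_le (R : realType) (h : nat -> R) (W : R) : (forall n, 0 <= h n) ->
  (forall N, \sum_(n < N) h n <= W) ->
  (\esum_(n in [set: int]) (h `|n|%N)%:E < +oo)%E.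
Proof.
move=> h0 hW.
have nat_le (k : nat -> R) : (forall n, 0 <= k n) -> (forall N, \sum_(n < N) k n <= W) ->
    (\esum_(n in [set: nat]) (k n)%:E <= W%:E)%E.
  move=> k0 kW; rewrite -nneseries_esumT => [|n]; last by rewrite lee_fin.
  apply: lime_le; first by apply: is_cvg_nneseries => n _ _; rewrite lee_fin.
  by apply: nearW => N; rewrite sumEFin big_mkord lee_fin.
have hZ0 n : (0 <= (h `|n : int|%N)%:E)%E by rewrite lee_fin.
rewrite (esumID [set Posz x | x in [set: nat]])//.
have -> : [set: int] `&` ~` [set Posz x | x in [set: nat]] = [set Negz x | x in [set: nat]].
  rewrite setTI; apply/seteqP; split => [[] n // /(_ (ex_intro2 _ _ n I erefl))//|].
  by move=> _ [n _ <-] [].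
rewrite setTI !esum_image; [|by move=> ? ? _ _ []..].
apply: (@le_lt_trans _ _ (W%:E + W%:E)%E); last by rewrite -EFinD ltry.
apply: leeD; apply: nat_le => // N.
(* [Negz n] has absolute value n + 1, so the negative half is the sum over naturals without its term
   0. *)
by apply: le_trans (hW N.+1); rewrite big_ord_recl lerDr.
Qed.

Lemma truncated_sum_le (R : realType) (u : nat -> R) L N : (forall n, 0 <= u n) ->
  \sum_(n < N) (if (n < L)%N then u n else 0) <= \sum_(n < L) u n.
Proof.
move=> u0; pose t n := if (n < L)%N then u n else 0.
have t0 n : 0 <= t n by rewrite /t; case: ifP.
apply: (@le_trans _ _ (\sum_(n < L + N) t n)).
  by rewrite addnC big_split_ord /= lerDl sumr_ge0.
rewrite big_split_ord /= [X in _ + X]big1 ?addr0 => [|n _]; last first.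
  by rewrite /t ltnNge leq_addr.
by apply: ler_sum => n _; rewrite /t ltn_ord.
Qed.

Lemma sum_geometric_half_le (R : realFieldType) K :
  \sum_(k < K) 2 ^+ k.+1 / 4 ^+ k <= 4 :> R.
Proof.
suff -> : \sum_(k < K) 2 ^+ k.+1 / 4 ^+ k = 4 - 4 / 2 ^+ K :> R.
  by rewrite lerBlDr lerDl divr_ge0 ?exprn_ge0.
elim: K => [|K IH]; first by rewrite big_ord0 expr0 divr1 subrr.
rewrite big_ord_recr /= IH !exprS (_ : 4 = 2 * 2 :> R) ?exprMn; last by ring.
have ? : 2 ^+ K != 0 :> R by rewrite expf_neq0 ?pnatr_eq0.
by field.
Qed.

(** * Assembly of the function *)

Theorem theorem2p5 (R : realType) (lambda : nat -> R)
  (lambda_gt0 : forall n, 0 < lambda n)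
  (lambda_div : (\sum_(0 <= n <oo) ((lambda n)^-1)%:E)%E = +oo%E)
  (lambda_reg : nondecreasing_seq lambda \/
    exists2 C : R, 1 < C & forall n k : nat, (1 <= n)%N -> (n <= k <= 2 * n)%N ->
      C^-1 * lambda n <= lambda k <= C * lambda n) :
  exists f : circle R -> R,
    [/\ forall z, 0 < f z,
        f \in Lfun (@arc_length R) 2%:E,
        everywhere_locally_unbounded f &
        (\esum_(n in [set: int])
           (Normc.normc (fourier_coef f n) ^+ 2 * lambda `|n|%N)%:E < +oo)%E].
Proof.
have lambda_ge0 n : 0 <= lambda n by exact: ltW.
have invl_ge0 n : 0 <= (lambda n)^-1 by rewrite invr_ge0.
have [a [M [lM a01 aM ua]]] := dyadic_weights lambda_gt0
  (nneseries_unbounded_sums invl_ge0 lambda_div) lambda_reg.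
(* For the initial constant polynomial 1, the weighted energy is [lambda 0] and the L2 bound is 1;
   both are at most D. *)
pose D := 1 + lambda 0%N; have D1 : 1 <= D by rewrite lerDl.
have D0 : 0 < D by exact: lt_le_trans D1.
(* The decay 4^-k keeps the budgets summable against the weights 2^(k+1) of [sqr_sum_le]. *)
pose E k := D / 4 ^+ k.
have E0 k : 0 < E k by rewrite divr_gt0 ?exprn_gt0.
(* Index 0 is the constant 1, which supplies g 0 >= 1; index k + 1 is a peak at the 2^k-th roots of
   unity, hence the predecessors. *)
have /choice[p pP] : forall k, exists p : nat * (nat -> R), [/\ forall n, 0 <= p.2 n,
      \sum_(n < p.1.+1) p.2 n ^+ 2 * lambda n <= E k,
      p.2 0%N * \sum_(n < p.1.+1) p.2 n <= E k,
      forall w, normc w = 1 -> (k == 0%N)%:R <= cos_poly p.2 p.1.+1 w &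
      forall w : R[i], w ^+ (2 ^ k.-1) = 1 -> k.-1%:R < cos_poly p.2 p.1.+1 w].
  case=> [|k].
    exists (0%N, fun=> 1); split => [n||||] /=;
      rewrite /cos_poly ?big_ord1 ?expr1n /E ?expr0 ?divr1 ?mul1r//.
      by rewrite lerDr.
    by move=> w _; rewrite big_ord1 expr0 mul1r.
    by move=> w _; rewrite big_ord1 expr0 mul1r ltr01.
  have [L [c [c0 c1 c2 c3 c4]]] := exists_peak lambda_ge0 lM a01 aM ua k (ltr0Sn R k) (E0 k.+1).
  exists (L, c); split => //= w /c4; apply: le_lt_trans; by rewrite ler_nat.
pose g k (z : circle R) := cos_poly (p k).2 (p k).1.+1 (val z).
have mg k : measurable_fun setT (g k) by exact: measurable_cos_poly.
have g_ge0 k z : 0 <= g k z.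
  have [_ _ _ h _] := pP k; apply: le_trans (h _ (normc_circle z)); exact: ler0n.
have g0_ge1 z : 1 <= g 0%N z.
  by have [_ _ _ h _] := pP 0%N; apply: le_trans (h _ (normc_circle z)).
have p0 k n : 0 <= (p k).2 n by have [h _ _ _ _] := pP k.
have gE k : (\int[@arc_length R]_z (g k z ^+ 2)%:E <= (E k)%:E)%E.
  have [_ _ h _ _] := pP k.
  by apply: le_trans (integral_sqr_cos_poly (p0 k) (g_ge0 k)) _; rewrite lee_fin.
have EB K : \sum_(k < K) 2 ^+ k.+1 * E k <= 4 * D.
  rewrite (eq_bigr (fun k : 'I_K => 2 ^+ k.+1 / 4 ^+ k * D)) => [|k _]; last first.
    by rewrite /E mulrCA mulrC.
  by rewrite -mulr_suml ler_wpM2r ?(ltW D0)// sum_geometric_half_le.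
have [f [f0 fL2 fg fh]] := exists_L2_sum mg g_ge0 g0_ge1 gE EB.
exists f; split => //.
  apply: (@everywhere_locally_unboundedP _ f (fun k => (p k.+1).2) (fun k => (p k.+1).1.+1)).
    by apply: filterS fg => z h k; exact: h.
  by move=> k; have [_ _ _ _] := pP k.+1.
pose t k n := if (n < (p k).1.+1)%N then (p k).2 n else 0.
have sinE s n : `|s| <= 1 -> (\int[@arc_length R]_z (f z * (s * sinz n z)) = 0)%R.
  move=> s1.
  have /fh : measurable_fun setT (fun z : circle R => s * sinz n z) by exact: measurable_funM.
  have ssin z : `|s * sinz n z| <= 1 by rewrite normrM mulr_ile1 ?normr_sinz_le1.
  move=> /(_ ssin) /cvg_lim <- //.
  rewrite (_ : (fun K => _) = cst 0) ?lim_cst//.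
  by apply/funext => K; rewrite big1// => k _; exact: integral_cos_poly_sinz.
pose h n := (\int[@arc_length R]_z (f z * cosz n z)) ^+ 2 * lambda n.
have -> : (fun n : int => (normc (fourier_coef f n) ^+ 2 * lambda `|n|%N)%:E) =
    (fun n : int => (h `|n|%N)%:E).
  apply/funext => n; have [s s1 ->] := normc_fourier_coef f n.
  by rewrite sinE// expr0n addr0.
apply: (@esum_int_le _ h (4 * D)) => [n|N]; first by rewrite mulr_ge0 ?sqr_ge0.
(* N is fixed while K tends to infinity, so a bound uniform in K and N passes to the coefficients of
   f. *)
have cvh : \sum_(n < N)
    ((\sum_(k < K) \int[@arc_length R]_z (g k z * cosz n z)) ^+ 2 * lambda n)
    @[K --> \oo] --> \sum_(n < N) h n.
  apply: cvg_big => [|n _]; first exact: add_continuous.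
  apply: cvgM; last exact: cvg_cst.
  by rewrite expr2; apply: cvgM; apply: fh => // z; exact: normr_cosz_le1.
rewrite -(cvg_lim _ cvh)//; apply: limr_le; first by apply/cvg_ex; eexists; exact: cvh.
apply: nearW => K.
(* The weighted Cauchy-Schwarz bound, now applied at each frequency to the coefficients of the
   summands; exchanging the sums leaves their individual energies. *)
apply: (@le_trans _ _ (\sum_(n < N) \sum_(k < K) 2 ^+ k.+1 * (t k n ^+ 2 * lambda n))).
  apply: ler_sum => n _; under [leRHS]eq_bigr do rewrite mulrA.
  rewrite -mulr_suml ler_wpM2r//; apply: (le_trans _ (sqr_sum_le (t ^~ n) K)).
  rewrite -[leLHS]real_normK ?num_real// ler_pXn2r ?nnegrE ?sumr_ge0//; last first.
    by move=> k _; rewrite /t; case: ifP.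
  apply: le_trans (ler_norm_sum _ _ _) _; apply: ler_sum => k _.
  exact: normr_integral_cos_poly_cosz.
rewrite exchange_big /=; apply: le_trans (EB K); apply: ler_sum => k _.
rewrite -mulr_sumr ler_wpM2l ?exprn_ge0//; have [_ hk _ _ _] := pP k; apply: le_trans hk.
have := @truncated_sum_le R (fun n => (p k).2 n ^+ 2 * lambda n) (p k).1.+1 N.
move=> /(_ (fun n => mulr_ge0 (sqr_ge0 _) (lambda_ge0 n))); apply: le_trans.
by apply: ler_sum => n _; rewrite /t; case: ifP => // _; rewrite expr0n mul0r.
Qed.
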